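(* (a) For every finite set $N$ of agents and finite set $O$ of objects with copy numbers $(q_x)_{x\in O}$ satisfying $\sum_{x\in O}q_x\ge|N|$, every random assignment rule $f:\mathcal{R}\to\Delta(\mathcal{M})$ that satisfies probabilistic monotonicity is strategy-proof. (b) The converse does not hold: there exist a finite set $N$ of agents, a finite set $O$ of objects with copy numbers $(q_x)_{x\in O}$ satisfying $\sum_{x\in O}q_x\ge|N|$, and a strategy-proof random assignment rule $f:\mathcal{R}\to\Delta(\mathcal{M})$ such that $f$ itself, as well as every random assignment rule $g:\mathcal{R}\to\Delta(\mathcal{M})$ that yields the same individual object assignment probabilities (i.e. $g^{ia}(R)=f^{ia}(R)$ for all $R\in\mathcal{R}$, $i\in N$, $a\in O$), fails to satisfy probabilistic monotonicity.
   Context: Setting. $N$ is a finite set of agents, $O$ a finite set of objects; object $x\in O$ has $q_x\geq 1$ copies, and $\sum_{x\in O}q_x\ge|N|$. Each agent $i$ has a strict preference $R_i$ over $O$ (a linear order) with asymmetric part $P_i$; $\mathcal{R}$ is the set of all profiles $R=(R_i)_{i\in N}$ of linear orders on $O$. $U(x,R_i)=\{y\in O:y\,P_i\,x\}$. An assignment is a map $\mu:N\to O$ with $|\{i:\mu_i=x\}|\le q_x$ for all $x$; $\mathcal{M}$ is the set of assignments, $\Delta(\mathcal{M})$ the set of probability distributions on $\mathcal{M}$. A random assignment rule is a map $f:\mathcal{R}\to\Delta(\mathcal{M})$; $f_\mu(R)$ is the probability of $\mu$ under $f(R)$, and $f^{ia}(R)=\sum_{\mu:\mu_i=a}f_\mu(R)$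 is the probability that agent $i$ is assigned object $a$. - Probabilistic monotonicity: for all $R,R'\in\mathcal{R}$ and $\mu\in\mathcal{M}$ with $U(\mu_i,R'_i)\subseteq U(\mu_i,R_i)$ for all $i\in N$, one has $f_\mu(R')\ge f_\mu(R)$. - Strategy-proofness (stochastic dominance sense): for all $R\in\mathcal{R}$, $i\in N$, every linear order $R'_i$ on $O$, and all $x\in O$, $\sum_{y\in U(x,R_i)}f^{iy}(R)\ge\sum_{y\in U(x,R_i)}f^{iy}(R'_i,R_{-i})$. *)

(* Defs.v *)
From HB Require Import structures.
From mathcomp Require Import all_boot all_order all_algebra.
From mathcomp Require Import reals.

Set Implicit Arguments.
Unset Strict Implicit.
Unset Printing Implicit Defensive.

Import Order.TTheory GRing.Theory Num.Theory.
Local Open Scope ring_scope.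

Section Preferences.
Variable O : finType.

Definition linear_order (r : {set O * O}) : bool :=
  [&& [forall x, (x, x) \in r],
      [forall x, forall y, ((x, y) \in r) && ((y, x) \in r) ==> (x == y)],
      [forall x, forall y, forall z,
         ((x, y) \in r) && ((y, z) \in r) ==> ((x, z) \in r)]
    & [forall x, forall y, ((x, y) \in r) || ((y, x) \in r)]].

(* The pair (x, y) belongs to the relation iff x is weakly preferred to y.    *)
Record preference := Preference {
  pref_rel : {set O * O};
  pref_linear : linear_order pref_rel }.

HB.instance Definition _ := [isSub for pref_rel].
HB.instance Definition _ := [Finite of preference by <:].

Definition weakly_prefers (Ri : preference) (x y : O) : bool :=
  (x, y) \in pref_rel Ri.

Definition strictly_prefers (Ri : preference) (x y : O) : bool :=
  weakly_prefers Ri x y && ~~ weakly_prefers Ri y x.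

Definition upper_contour (x : O) (Ri : preference) : {set O} :=
  [set y | strictly_prefers Ri y x].

End Preferences.

Section Rules.
Variables (N O : finType).

Definition profile := {ffun N -> preference O}.

Definition deviation (P : profile) (i : N) (Ri' : preference O) : profile :=
  [ffun j => if j == i then Ri' else P j].

Record assignment (q : O -> nat) := Assignment {
  assign : {ffun N -> O};
  assign_feasible : [forall x, #|[set i | assign i == x]| <= q x]%N }.

HB.instance Definition _ (q : O -> nat) := [isSub for @assign q].
HB.instance Definition _ (q : O -> nat) := [Finite of assignment q by <:].

End Rules.

Record distribution (R : realType) (T : finType) := Distribution {
  prob : {ffun T -> R};
  prob_ge0 : forall t, 0 <= prob t;
  prob_sum1 : \sum_t prob t = 1 }.

Definition random_rule (R : realType) (N O : finType) (q : O -> nat) :=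
  profile N O -> distribution R (assignment N q).

Section Properties.
Variables (R : realType) (N O : finType) (q : O -> nat).
Implicit Types f g : random_rule R N q.

Definition object_prob f (P : profile N O) (i : N) (a : O) : R :=
  \sum_(mu : assignment N q | assign mu i == a) prob (f P) mu.

Definition probabilistically_monotonic f : Prop :=
  forall (P P' : profile N O) (mu : assignment N q),
    (forall i : N, upper_contour (assign mu i) (P' i)
                     \subset upper_contour (assign mu i) (P i)) ->
    prob (f P) mu <= prob (f P') mu.

Definition strategy_proof f : Prop :=
  forall (P : profile N O) (i : N) (Ri' : preference O) (x : O),
    \sum_(y in upper_contour x (P i)) object_prob f (deviation P i Ri') i y
      <= \sum_(y in upper_contour x (P i)) object_prob f P i y.

Definition same_object_probs f g : Prop :=
  forall (P : profile N O) (i : N) (a : O),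
    object_prob g P i a = object_prob f P i a.

End Properties.

(* Main.v *)
(** Monotonicity implies strategy-proofness: let [U] be an upper contour set of
    agent [i]'s true preference [Ri], let [Ri'] be a misreport, and let [Ri'']
    rank [U] above its complement, following [Ri] inside [U] and [Ri'] outside.
    Objects in [U] have the same upper contour set under [Ri] and [Ri''], so [i]
    receives an object of [U] with the same probability under both. An object
    outside [U] has a smaller upper contour set under [Ri'] than under [Ri''], so
    reporting [Ri'] can only raise the probability of ending outside [U].

    For the converse, a deterministic rule suffices, since its marginals
    determine it. Two agents, two objects, two copies each: the first agent
    always receives the same object, and the second agent receives the first
    agent's favourite. Nobody influences their own object, yet when the first
    agent's constant object moves to the top of his ranking the realised
    assignment is abandoned. *)
Require Import Defs.
From mathcomp Require Import all_boot all_order all_algebra.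
From mathcomp Require Import reals.

Set Implicit Arguments.
Unset Strict Implicit.
Unset Printing Implicit Defensive.

Import Order.TTheory GRing.Theory Num.Theory.
Local Open Scope ring_scope.

Section Preferences.
Variable O : finType.
Implicit Types (r : {set O * O}) (U : {set O}) (S T : preference O).

Lemma linear_orderP r :
  reflect [/\ forall x, (x, x) \in r,
              forall x y, (x, y) \in r -> (y, x) \in r -> x = y,
              forall x y z, (x, y) \in r -> (y, z) \in r -> (x, z) \in r &
              forall x y, ((x, y) \in r) || ((y, x) \in r)]
          (linear_order r).
Proof.
apply: (iffP and4P) => -[r_refl r_anti r_trans r_total]; split.
- exact/forallP.
- move=> x y xy yx; move/forallP/(_ x)/forallP/(_ y): r_anti.
  by rewrite xy yx => /eqP.
- move=> x y z xy yz.
  by move/forallP/(_ x)/forallP/(_ y)/forallP/(_ z): r_trans; rewrite xy yz.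
- by move=> x y; move/forallP/(_ x)/forallP/(_ y): r_total.
- exact/forallP.
- apply/forallP => x; apply/forallP => y; apply/implyP => /andP[xy yx].
  exact/eqP/r_anti.
- apply/forallP => x; apply/forallP => y; apply/forallP => z.
  by apply/implyP => /andP[]; apply: r_trans.
- by apply/forallP => x; apply/forallP.
Qed.

Lemma weakly_prefers_refl S x : weakly_prefers S x x.
Proof. by case/linear_orderP: (pref_linear S) => refl _ _ _; apply: refl. Qed.

Lemma weakly_prefers_anti S x y :
  weakly_prefers S x y -> weakly_prefers S y x -> x = y.
Proof. by case/linear_orderP: (pref_linear S) => _ anti _ _; apply: anti. Qed.

Lemma weakly_prefers_trans S x y z :
  weakly_prefers S x y -> weakly_prefers S y z -> weakly_prefers S x z.
Proof. by case/linear_orderP: (pref_linear S) => _ _ trans _; apply: trans. Qed.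

Lemma weakly_prefers_total S x y : weakly_prefers S x y || weakly_prefers S y x.
Proof. by case/linear_orderP: (pref_linear S) => _ _ _ total; apply: total. Qed.

Lemma strictly_prefersE S x y : strictly_prefers S x y = ~~ weakly_prefers S y x.
Proof.
rewrite /strictly_prefers; case: (boolP (weakly_prefers S y x)) => yx.
  by rewrite andbF.
by have := weakly_prefers_total S x y; rewrite (negPf yx) orbF => ->.
Qed.

Definition splice_rel U S T : {set O * O} :=
  [set p | if p.1 \in U then (p.2 \in U) ==> weakly_prefers S p.1 p.2
           else (p.2 \notin U) && weakly_prefers T p.1 p.2].

Lemma splice_linear U S T : linear_order (splice_rel U S T).
Proof.
apply/linear_orderP; split=> [x|x y|x y z|x y]; rewrite !inE /=.
- by case: (x \in U); rewrite weakly_prefers_refl.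
- by case: (x \in U); case: (y \in U) => //=; apply: weakly_prefers_anti.
- by case: (x \in U); case: (y \in U); case: (z \in U) => //=;
    apply: weakly_prefers_trans.
- by case: (x \in U); case: (y \in U) => //=; apply: weakly_prefers_total.
Qed.

Definition splice U S T : preference O := Preference (splice_linear U S T).

Lemma upper_contour_splice_in U S T x : x \in U ->
  upper_contour x (splice U S T) = U :&: upper_contour x S.
Proof.
move=> Ux; apply/setP => y; rewrite !inE !strictly_prefersE.
by rewrite /weakly_prefers /= inE /= Ux negb_imply.
Qed.

Lemma upper_contour_splice_out U S T x : x \notin U ->
  upper_contour x (splice U S T) = U :|: upper_contour x T.
Proof.
move=> Ux; apply/setP => y; rewrite !inE !strictly_prefersE.
by rewrite /weakly_prefers /= inE /= (negPf Ux) negb_and negbK.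
Qed.

Lemma upper_contour_subset S x y : y \in upper_contour x S ->
  upper_contour y S \subset upper_contour x S.
Proof.
rewrite inE strictly_prefersE => nxy; apply/subsetP => z.
rewrite !inE !strictly_prefersE; apply: contra => xz.
have := weakly_prefers_total S y z; case/orP => // zy.
by case/negP: nxy; apply: weakly_prefers_trans zy.
Qed.

End Preferences.

Section Rules.
Variables (R : realType) (N O : finType) (q : O -> nat).
Implicit Types (f g : random_rule R N q) (U : {set O}).

Lemma sum_object_prob f (P : profile N O) i U :
  \sum_(y in U) object_prob f P i y =
  \sum_(mu : assignment N q | assign mu i \in U) prob (f P) mu.
Proof.
rewrite (partition_big (fun mu : assignment N q => assign mu i) (mem U)) //=.
apply: eq_bigr => y Uy; apply: eq_bigl => mu.
by case: eqP => [->|]; rewrite ?andbF // Uy.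
Qed.

Lemma monotonic_strategy_proof f :
  probabilistically_monotonic f -> strategy_proof f.
Proof.
move=> mono P i T x; set U := upper_contour x (P i).
have mono_i (S S' : preference O) (mu : assignment N q) :
    upper_contour (assign mu i) S' \subset upper_contour (assign mu i) S ->
    prob (f (deviation P i S)) mu <= prob (f (deviation P i S')) mu.
  move=> sub; apply: mono => j; rewrite !ffunE.
  by case: eqP => // ->.
have devP : deviation P i (P i) = P.
  by apply/ffunP => j; rewrite ffunE; case: eqP => // ->.
have prob_outside (Q : profile N O) :
    \sum_(mu : assignment N q | assign mu i \in U) prob (f Q) mu =
    1 - \sum_(mu : assignment N q | assign mu i \notin U) prob (f Q) mu.
  rewrite -(prob_sum1 (f Q)).
  rewrite [in RHS](bigID (fun mu : assignment N q => assign mu i \in U)) /=.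
  by rewrite addrK.
rewrite !sum_object_prob -[in leRHS]devP.
apply: (@le_trans _ _ (\sum_(mu : assignment N q | assign mu i \in U)
   prob (f (deviation P i (splice U (P i) T))) mu)).
  (* Monotonicity bounds each term outside [U]; total mass 1 turns this into the reverse bound
     inside [U]. *)
  rewrite !prob_outside lerD2l lerN2; apply: ler_sum => mu out.
  by apply: mono_i; rewrite upper_contour_splice_out // subsetUr.
apply: ler_sum => mu inU; apply: mono_i.
(* Intersecting with [U] loses nothing, because [U] is itself an upper contour set of [P i]. *)
by rewrite upper_contour_splice_in // subsetI subxx upper_contour_subset.
Qed.

Lemma point_mass_ge0 (T : finType) (t u : T) :
  0 <= [ffun v => (v == t)%:R : R] u.
Proof. by rewrite ffunE ler0n. Qed.

Lemma point_mass_sum1 (T : finType) (t : T) :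
  \sum_u [ffun v => (v == t)%:R : R] u = 1.
Proof.
rewrite (bigD1 t) //= ffunE eqxx big1 ?addr0 // => u.
by rewrite ffunE => /negPf ->.
Qed.

Definition point_mass (T : finType) (t : T) : distribution R T :=
  Distribution (point_mass_ge0 t) (point_mass_sum1 t).

Definition deterministic_rule (m : profile N O -> assignment N q) :
  random_rule R N q := fun P => point_mass (m P).

Lemma object_prob_deterministic m P i a :
  object_prob (deterministic_rule m) P i a = (assign (m P) i == a)%:R.
Proof.
rewrite /object_prob big_mkcond (bigD1 (m P)) //= ffunE eqxx big1 ?addr0.
  by case: eqP.
by move=> mu /negPf mu_m; rewrite ffunE mu_m; case: ifP.
Qed.

Lemma self_independent_strategy_proof f :
  (forall P i T a, object_prob f (deviation P i T) i a = object_prob f P i a) ->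
  strategy_proof f.
Proof. by move=> indep P i T x; rewrite (eq_bigr _ (fun a _ => indep P i T a)). Qed.

(* If [i] surely receives [a] and [a] rises in [i]'s ranking, the support of
   [g P] consists of assignments that may only become more likely. *)
Lemma monotonic_object_prob g P i T a j b :
  probabilistically_monotonic g -> object_prob g P i a = 1 ->
  upper_contour a T \subset upper_contour a (P i) ->
  object_prob g P j b <= object_prob g (deviation P i T) j b.
Proof.
move=> mono sure_a sub; apply: ler_sum => mu _.
have [mu_a|mu_a] := eqVneq (assign mu i) a.
  apply: mono => k; rewrite ffunE.
  by case: eqP => // ->; rewrite mu_a.
suff -> : prob (g P) mu = 0 by apply: prob_ge0.
(* The assignments giving [a] to [i] already carry mass 1, so adding the mass of [mu] must not
   exceed 1. *)
apply/eqP; rewrite eq_le prob_ge0 andbT -(lerD2l 1) addr0.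
rewrite -{1}sure_a -(prob_sum1 (g P)).
rewrite [leRHS](bigID (fun nu : assignment N q => assign nu i == a)) /=.
rewrite lerD2l (bigD1 mu) //= lerDl.
by apply: sumr_ge0 => nu _; apply: prob_ge0.
Qed.

End Rules.

Definition top_rel (b : bool) : {set bool * bool} :=
  [set p | (p.1 == b) || (p.2 != b)].

Lemma top_linear b : linear_order (top_rel b).
Proof.
by apply/linear_orderP; split; do ?[case]; rewrite ?inE //; case: b; rewrite ?inE.
Qed.

Definition top_pref b : preference bool := Preference (top_linear b).

(** Both agents and objects are booleans. Agent [true] always gets object [true]; for agent [false]
    the value of the test is itself the favourite object of agent [true]. *)
Definition bossy_fun (P : profile bool bool) : {ffun bool -> bool} :=
  [ffun i => i || weakly_prefers (P true) true false].

Lemma bossy_feasible P :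
  [forall x, #|[set i | bossy_fun P i == x]| <= 2]%N.
Proof. by apply/forallP => x; rewrite -card_bool max_card. Qed.

Definition bossy_assignment P : assignment bool (fun _ : bool => 2%N) :=
  @Assignment bool bool (fun _ => 2%N) (bossy_fun P) (bossy_feasible P).

Lemma bossy_strategy_proof (R : realType) :
  strategy_proof (deterministic_rule R bossy_assignment).
Proof.
apply: self_independent_strategy_proof => P i T a.
(* The object of agent [true] is constant, and that of agent [false] depends only on the report of
   agent [true]. *)
by rewrite !object_prob_deterministic /= !ffunE; case: i.
Qed.

Lemma bossy_not_monotonic (R : realType)
    (g : random_rule R bool (fun _ : bool => 2%N)) :
  same_object_probs (deterministic_rule R bossy_assignment) g ->
  ~ probabilistically_monotonic g.
Proof.
move=> same mono; pose P : profile bool bool := [ffun _ => top_pref false].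
have sure : object_prob g P true true = 1.
  by rewrite same object_prob_deterministic /= ffunE.
have sub : upper_contour true (top_pref true) \subset upper_contour true (P true).
  by apply/subsetP => y; rewrite inE strictly_prefersE /weakly_prefers inE.
(* Agent [false] gets object [false] with probability 1 at [P], but 0 once agent [true] ranks [true]
   first. *)
have := monotonic_object_prob false false mono sure sub.
rewrite !same !object_prob_deterministic /= !ffunE /= /weakly_prefers !inE.
by rewrite ler10.
Qed.

Theorem corollary2 (R : realType) :
  (forall (N O : finType) (q : O -> nat),
     (forall x : O, 1 <= q x)%N ->
     (#|N| <= \sum_(x : O) q x)%N ->
     forall f : random_rule R N q,
       probabilistically_monotonic f -> strategy_proof f)
  /\
  (exists (N O : finType) (q : O -> nat),
     [/\ (forall x : O, 1 <= q x)%N,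
         (#|N| <= \sum_(x : O) q x)%N &
         exists f : random_rule R N q,
           [/\ strategy_proof f,
               ~ probabilistically_monotonic f &
               forall g : random_rule R N q,
                 same_object_probs f g -> ~ probabilistically_monotonic g]]).
Proof.
split=> [N O q _ _ f|]; first exact: monotonic_strategy_proof.
exists bool, bool, (fun=> 2%N); split=> //; first by rewrite sum_nat_const card_bool.
exists (deterministic_rule R bossy_assignment); split.
- exact: bossy_strategy_proof.
(* The rule itself is the case [g = f]. *)
- exact: bossy_not_monotonic.
- exact: bossy_not_monotonic.
Qed.
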